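(* Let $n\ge3$, $\beta\in(n-1,n]$, let $k$ be a real constant, let $f\in L^\infty(\mathbb{R}^{n-1})$, and let $$u(x)=k\int_{\mathbb{R}^{n-1}}\left(\frac{x_n}{|y-x|}\right)^{\beta} f(y')\,dy',\qquad x\in\mathbb{R}^n_+,\ y=(y',0).$$ Let $x$ be an arbitrary point in $\mathbb{R}^n_+$. The sharp coefficient $\mathcal{C}_{1,\beta,\infty}(x)$ in the inequality $$|\nabla u(x)|\le\mathcal{C}_{1,\beta,\infty}(x)\,\|f\|_\infty$$ is given by $$\mathcal{C}_{1,\beta,\infty}(x)=\frac{|k|\,\pi^{(n-1)/2}(n-1)\,\Gamma\left(\frac{\beta-n+1}{2}\right)}{\Gamma\left(\frac{\beta}{2}\right)}\,x_n^{n-2}.$$ The absolute value of the derivative of $u$ with respect to the normal to the boundary of the half-space at any $x\in\mathbb{R}^n_+$ has the same supremum as $|\nabla u(x)|$.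
   Context: $\mathbb{R}^n_+=\{x=(x',x_n):x'\in\mathbb{R}^{n-1},\ x_n>0\}$. $\|\cdot\|_\infty$ is the norm of $L^\infty(\mathbb{R}^{n-1})$ (real-valued functions). ''Sharp coefficient'' at a given $x$ means the smallest constant for which the inequality holds for all $f\in L^\infty(\mathbb{R}^{n-1})$. The derivative with respect to the normal is $\partial u/\partial x_n$, and the suprema are over all $f$ with $\|f\|_\infty\le1$; i.e. the last assertion says the same coefficient is sharp in $|\partial u(x)/\partial x_n|\le\mathcal{C}_{1,\beta,\infty}(x)\|f\|_\infty$. *)

(* Defs.v *)
From HB Require Import structures.
From mathcomp Require Import all_boot all_order all_algebra.
From mathcomp Require Import all_classical all_reals all_analysis.

Set Implicit Arguments.
Unset Strict Implicit.
Unset Printing Implicit Defensive.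

Import Order.TTheory GRing.Theory Num.Theory.
Import numFieldNormedType.Exports.

Local Open Scope classical_set_scope.
Local Open Scope ring_scope.

Section lebesgue_tuple.
Variable R : realType.

Definition tuple_cons d (p : d.-tuple R * R) : d.+1.-tuple R :=
  [tuple of p.2 :: p.1].

Lemma measurable_tuple_cons d : measurable_fun setT (@tuple_cons d).
Proof. exact: measurable_cons. Qed.

Definition lebesgue_tupleS d (mu : {measure set (d.-tuple R) -> \bar R}) :=
  pushforward (mu \x lebesgue_measure)%E (@tuple_cons d).

Section lebesgue_tupleS_measure.
Variables (d : nat) (mu : {measure set (d.-tuple R) -> \bar R}).

Let lebesgue_tupleS0 : lebesgue_tupleS mu set0 = 0%E.
Proof. by rewrite /lebesgue_tupleS /pushforward preimage_set0 measure0. Qed.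

Let lebesgue_tupleS_ge0 A : (0 <= lebesgue_tupleS mu A)%E.
Proof. by rewrite /lebesgue_tupleS /pushforward; apply: integral_ge0. Qed.

Let lebesgue_tupleS_sigma_additive : semi_sigma_additive (lebesgue_tupleS mu).
Proof.
by apply: measure_semi_sigma_additive; exact: measurable_tuple_cons.
Qed.

HB.instance Definition _ := isMeasure.Build _ _ _ (lebesgue_tupleS mu)
  lebesgue_tupleS0 lebesgue_tupleS_ge0 lebesgue_tupleS_sigma_additive.

End lebesgue_tupleS_measure.

(* Lebesgue measure on R^d (on the product, i.e. Borel, sigma-algebra of
   d.-tuple R), by iterating the product with the Lebesgue measure on R; the
   base case is the unit mass on the one-point space R^0. *)
Fixpoint lebesgue_tuple d : {measure set (d.-tuple R) -> \bar R} :=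
  match d with
  | 0 => \d_[tuple]
  | d'.+1 => lebesgue_tupleS (lebesgue_tuple d')
  end.

End lebesgue_tuple.
Arguments lebesgue_tuple : clear implicits.

Section definitions.
Variable R : realType.

(* Euler's integral; this is the Gamma function for s > 0 only. *)
Definition Gamma (s : R) : R :=
  \int[@lebesgue_measure R]_(t in `]0, +oo[) (t `^ (s - 1) * expR (- t)).

(* The Euclidean norm: the library's norm on row vectors is the sup norm. *)
Definition enorm d (v : 'rV[R]_d) : R := Num.sqrt (\sum_i v 0 i ^+ 2).

(* Below, d = n - 1 is the dimension of the boundary of the half-space: R^n is
   'rV[R]_d.+1, with x_n the coordinate of index ord_max, and functions on
   R^(n-1) have domain d.-tuple R. *)

Definition half_space d : set 'rV[R]_d.+1 := [set x | 0 < x 0 ord_max].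

(* y = (y', 0): the last index d is out of range for y', and nth returns 0. *)
Definition boundary_point d (y' : d.-tuple R) : 'rV[R]_d.+1 :=
  \row_(i < d.+1) nth 0 y' i.

Definition potential d (k beta : R) (f : d.-tuple R -> R) (x : 'rV[R]_d.+1)
    : R :=
  k * \int[lebesgue_tuple R d]_y'
        ((x 0 ord_max / enorm (boundary_point y' - x)) `^ beta * f y').

Definition partial d (u : 'rV[R]_d -> R) (i : 'I_d) (x : 'rV[R]_d) : R :=
  'D_(delta_mx 0 i) u x.

Definition grad d (u : 'rV[R]_d -> R) (x : 'rV[R]_d) : 'rV[R]_d :=
  \row_i partial u i x.

Definition Linfty d : set (d.-tuple R -> R) :=
  [set f | f \in Lfun (lebesgue_tuple R d) +oo%E].

Definition Linfty_norm d (f : d.-tuple R -> R) : \bar R :=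
  'N[lebesgue_tuple R d]_+oo%E[EFin \o f].

Definition admissible_coefficients d (Q : (d.-tuple R -> R) -> R) : set R :=
  [set C | forall f, Linfty f -> ((Q f)%:E <= C%:E * Linfty_norm f)%E].

Definition is_sharp_coefficient d (Q : (d.-tuple R -> R) -> R) (C : R)
    : Prop :=
  admissible_coefficients Q C /\ lbound (admissible_coefficients Q) C.

Definition Linfty_ball d : set (d.-tuple R -> R) :=
  [set f | Linfty f /\ (Linfty_norm f <= 1)%E].

End definitions.
Arguments Linfty {R d}.
Arguments Linfty_ball {R d}.
Arguments half_space {R d}.

(* Main.v *)
Require Import Defs.
From HB Require Import structures.
From mathcomp Require Import all_boot all_order all_algebra.
From mathcomp Require Import all_classical all_reals all_analysis.
From mathcomp Require Import measurable_realfun ess_sup_inf.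
From mathcomp Require Import ring lra.
Import Order.TTheory GRing.Theory Num.Theory.
Import numFieldNormedType.Exports.
Local Open Scope classical_set_scope.
Local Open Scope ring_scope.

(** Write d = n - 1, w = (y', 0) - x for the line of sight from x to the
    boundary point, and K(x, y') = (x_n / |w|)^beta, so that u = k int K f.

    The total mass of the kernel is explicit: int K dy' = c x_n^d with
    c = pi^(d/2) Gamma((beta - d)/2) / Gamma(beta/2).  It comes from writing
    |w|^(-beta) as a Gamma integral of Gaussians and exchanging the integrals
    ([integral_powR_sqdist], [integral_kernel]).  The kernel is comparable to
    K(x, .) uniformly near x, so u may be differentiated under the integral
    sign for every essentially bounded f ([cvg_potential]); the logarithmic
    derivative of K in the direction v is beta phi(v), with
    phi(v) = v_n / x_n + (w . v) / |w|^2.  Applied to f = 1, where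
    u = k c x_n^d, this gives int beta K phi(v) dy' = c d x_n^(d-1) v_n
    ([Rintegral_kernel_deriv]): derivatives along the boundary integrate to
    zero, and no further integral has to be computed.

    For a unit vector z the derivative of u in the direction z is at most
    |k| |f|_oo int beta K |phi(z)| dy', so the point is to see that this last
    integral is largest for z = e_n.  The vector p = x_n phi is the orthogonal
    projection of e_n on the hyperplane normal to w, hence by Thales it lies on
    the sphere of diameter [0, e_n]: |p . z - z_n / 2| <= 1/2.  This turns into
    |p . z| <= z_n (p . z) + (1 - z_n^2) / 2 ([norm_kernel_slope_le_unit]),
    whose right-hand side integrates exactly:
      int beta K |phi(z)| <= c x_n^(d-1) (d z_n^2 + (1 - z_n^2) beta / 2),
    and this is at most c d x_n^(d-1) as soon as beta <= 2 d, which follows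
    from beta <= n.

    The bound is attained by f = 1, whose potential has the normal derivative
    k c d x_n^(d-1); both sharp coefficients and both suprema are therefore
    |k| c d x_n^(d-1) ([sharp_at_cst1]). *)

Set Implicit Arguments.
Unset Strict Implicit.
Unset Printing Implicit Defensive.

(** * Lebesgue measure on tuples *)

Section sigma_finite_of.
Context dT (T : measurableType dT) (R : realType).
Variables (m : {measure set T -> \bar R}).

(** A copy of m that carries a proof of sigma-finiteness, so that Tonelli's
    theorem applies to a measure known to be sigma-finite only by a lemma. *)
Definition sigma_finite_of of sigma_finite setT m : set T -> \bar R := m.

Hypothesis m_sfin : sigma_finite setT m.

HB.instance Definition _ := isMeasure.Build _ _ _ (sigma_finite_of m_sfin)
  (measure0 m) (measure_ge0 m) (@measure_semi_sigma_additive _ _ _ m).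

HB.instance Definition _ :=
  Measure_isSigmaFinite.Build _ _ _ (sigma_finite_of m_sfin) m_sfin.

End sigma_finite_of.

Section lebesgue_tuple_theory.
Variable R : realType.
Local Notation leb := (@lebesgue_measure R).

Lemma sigma_finite_lebesgue_tuple d :
  sigma_finite [set: d.-tuple R] (lebesgue_tuple R d).
Proof.
elim: d => [|d IH].
  exists (fun=> setT); first by rewrite bigcup_const.
  by move=> _; split => //; rewrite /= diracT ltry.
have /sigma_finiteP[F [FT ndF Foo]] := IH.
have /sigma_finiteP[G [GT ndG Goo]] := sigma_finiteT leb.
pose uncons (t : d.+1.-tuple R) := ([tuple of behead t], thead t).
have consK : @tuple_cons R d \; uncons = id.
  by apply/funext => -[p s]; congr pair; apply/val_inj.
have muncons : measurable_fun setT uncons.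
  apply/measurable_fun_pairP; split; first exact: measurable_behead.
  exact: measurable_tnth.
exists (fun k => uncons @^-1` (F k `*` G k)).
  rewrite -preimage_bigcup -[LHS](preimage_setT uncons); congr preimage.
  apply/seteqP; split=> // -[p s] _.
  have [i _ Fip] : (\bigcup_k F k) p by rewrite -FT.
  have [j _ Gjs] : (\bigcup_k G k) s by rewrite -GT.
  exists (maxn i j) => //; split.
    by move: p Fip; exact/subsetPset/ndF/leq_maxl.
  by move: s Gjs; exact/subsetPset/ndG/leq_maxr.
move=> k; have [mF Fk] := Foo k; have [mG Gk] := Goo k; split.
  by rewrite -[X in measurable X]setTI; apply: muncons => //; exact: measurableX.
rewrite /= /lebesgue_tupleS /pushforward -comp_preimage.
rewrite [_ \o _]consK preimage_id product_measure1E// lte_mul_pinfty//.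
by rewrite ge0_fin_numE.
Qed.

(* Lebesgue measure lives on this Borel structure, which is convertible to the
   one on the domain of tuple_cons, but not syntactically equal to it. *)
Local Notation borelR := (g_sigma_algebraType R.-ocitv.-measurable).

Let measurable_cons_borel d :
  measurable_fun [set: d.-tuple R * borelR] (@tuple_cons R d).
Proof. exact: measurable_tuple_cons. Qed.

Lemma ge0_integral_lebesgue_tupleS d (f : d.+1.-tuple R -> \bar R) :
  measurable_fun [set: d.+1.-tuple R] f -> (forall y, (0 <= f y)%E) ->
  (\int[lebesgue_tuple R d.+1]_y f y =
   \int[lebesgue_tuple R d]_p \int[leb]_s f (tuple_cons (p, s)))%E.
Proof.
move=> mf f0.
pose mu := sigma_finite_of (@sigma_finite_lebesgue_tuple d).
have /= := @ge0_integral_pushforward _ _ _ _ _ _ (@measurable_cons_borel d)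
  (mu \x leb)%E _ f measurableT mf (fun y _ => f0 y).
rewrite preimage_setT => ->.
rewrite fubini_tonelli1//.
exact: (measurableT_comp mf (@measurable_cons_borel d)).
Qed.

Lemma integral_lebesgue_tuple_prod d (g : 'I_d -> R -> R) (c : 'I_d -> R) :
  (forall i, measurable_fun setT (g i)) -> (forall i s, 0 <= g i s) ->
  (forall i, (\int[leb]_s (g i s)%:E = (c i)%:E)%E) ->
  (\int[lebesgue_tuple R d]_y (\prod_i g i (tnth y i))%:E = (\prod_i c i)%:E)%E.
Proof.
have mprod n (h : 'I_n -> R -> R) : (forall i, measurable_fun setT (h i)) ->
    measurable_fun [set: n.-tuple R] (fun y : n.-tuple R => \prod_i h i (tnth y i)).
  move=> mh; apply: measurable_prod => i _.
  by apply: measurableT_comp => //; exact: measurable_tnth.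
elim: d g c => [|d IH] g c mg g0 gc.
  rewrite integral_dirac//=; last by apply/measurable_EFinP; exact: mprod.
  by rewrite [X in (X * _)%E]diracT mul1e !big_ord0.
have consE (p : d.-tuple R) (s : R) :
    \prod_i g i (tnth (tuple_cons (p, s)) i) =
    (\prod_i g (lift ord0 i) (tnth p i)) * g ord0 s.
  rewrite big_ord_recl tnth0 mulrC; congr (_ * _).
  by apply: eq_bigr => i _; rewrite tnthS; congr (g _ (tnth _ _)); exact/val_inj.
rewrite ge0_integral_lebesgue_tupleS; last 2 first.
- by apply/measurable_EFinP; exact: mprod.
- by move=> y; rewrite lee_fin prodr_ge0.
transitivity (\int[lebesgue_tuple R d]_p
    ((c ord0)%:E * (\prod_i g (lift ord0 i) (tnth p i))%:E))%E.
  apply: eq_integral => p _; rewrite -gc -ge0_integralZr//; last 3 first.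
  - by apply/measurable_EFinP; exact: mg.
  - by move=> s _; rewrite lee_fin.
  - by rewrite lee_fin prodr_ge0.
  by apply: eq_integral => s _; rewrite consE EFinM muleC.
rewrite ge0_integralZl//; last 3 first.
- by apply/measurable_EFinP; apply: (mprod _ (fun i => g (lift ord0 i))) => i.
- by move=> s _; rewrite lee_fin prodr_ge0.
- by rewrite -gc integral_ge0// => s _; rewrite lee_fin.
rewrite (IH (fun i => g (lift ord0 i)) (fun i => c (lift ord0 i)))//.
by rewrite big_ord_recl EFinM.
Qed.

Lemma lebesgue_tuple_setT_gt0 d : (0 < lebesgue_tuple R d [set: d.-tuple R])%E.
Proof.
elim: d => [|d IH]; first by rewrite /= diracT.
rewrite /= /lebesgue_tupleS /pushforward preimage_setT -setXTT product_measure1E//.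
apply: mule_gt0 => //.
apply: (@lt_le_trans _ _ (@lebesgue_measure R `[0, 1]%classic)).
  by rewrite lebesgue_measure_itv/= lte01 oppr0 adde0.
by apply: le_measure; rewrite ?inE.
Qed.

End lebesgue_tuple_theory.

(** * Integrals on the open half-line *)

Section half_line.
Variable R : realType.
Local Notation leb := (@lebesgue_measure R).

Lemma itv0y_bigcupV :
  `]0, +oo[%classic = \bigcup_n `[(n.+1%:R : R)^-1, +oo[%classic.
Proof.
apply/seteqP; split=> t /=; rewrite in_itv/= andbT.
- move=> t0; exists (Num.truncn t^-1) => //=; rewrite in_itv/= andbT.
  by rewrite invf_ple ?posrE// ltW// truncnS_gt.
- by move=> [n _]/=; rewrite in_itv/= andbT; apply: lt_le_trans.
Qed.

(** A function that may be singular at 0 is controlled on the half-lines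
    [a, +oo[, up to whose endpoint it is continuous; then a tends to 0. *)
Lemma integral_itv0y_le (f : R -> R) (B : \bar R) :
  measurable_fun (`]0, +oo[%classic : set R) f ->
  {in `]0, +oo[, forall t, 0 <= f t} ->
  (forall a, 0 < a -> (\int[leb]_(t in `[a, +oo[) (f t)%:E <= B)%E) ->
  (\int[leb]_(t in `]0%R, +oo[) (f t)%:E <= B)%E.
Proof.
move=> mf f0 fB.
have f0' t : `]0, +oo[%classic t -> (0 <= (f t)%:E)%E.
  by move=> t0; rewrite lee_fin f0.
have U0y k : `[(k.+1%:R : R)^-1, +oo[%classic `<=` `]0, +oo[%classic.
  by rewrite itv0y_bigcupV => t kt; exists k.
have S0y n : \big[setU/set0]_(k < n) `[(k.+1%:R : R)^-1, +oo[%classic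
    `<=` `]0, +oo[%classic.
  rewrite itv0y_bigcupV.
  exact: (@bigsetU_bigcup _ (fun k => `[(k.+1%:R : R)^-1, +oo[%classic)).
have mS k : measurable (seqDU (fun k => `[(k.+1%:R : R)^-1, +oo[%classic) k).
  by apply: measurableD => //; exact: bigsetU_measurable.
rewrite itv0y_bigcupV seqDU_bigcup_eq ge0_integral_bigcup//; last 2 first.
- by rewrite -seqDU_bigcup_eq -itv0y_bigcupV; exact/measurable_EFinP.
- by move=> t; rewrite -seqDU_bigcup_eq -itv0y_bigcupV; exact: f0'.
apply: lime_le => /=.
  apply: is_cvg_nneseries => n _ _.
  by apply: integral_ge0 => t [/U0y + _]; exact: f0'.
apply: nearW => n.
rewrite -ge0_integral_bigsetU//=; first last.
- by move=> t; rewrite big_mkord -bigsetU_seqDU => /S0y; exact: f0'.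
- apply/measurable_EFinP; apply: measurable_funS mf => //.
  by rewrite big_mkord -bigsetU_seqDU; exact: S0y.
- exact: (sub_trivIset (@subsetT _ _)).
- exact: iota_uniq.
rewrite big_mkord -bigsetU_seqDU.
apply: le_trans (fB n.+1%:R^-1 _); last by rewrite invr_gt0.
apply: ge0_subset_integral => //=.
- exact: bigsetU_measurable.
- by apply/measurable_EFinP; apply: measurable_funS mf.
- by move=> t /U0y; exact: f0'.
- move=> t; rewrite -(bigcup_mkord _ (fun k => `[(k.+1%:R : R)^-1, +oo[%classic)).
  move=> [k /= kn]; rewrite !in_itv/= !andbT; apply: le_trans.
  by rewrite lef_pV2 ?posrE// ler_nat ltnS ltnW.
Qed.

Lemma integral_itvcy_scale (f : R -> R) (c a : R) : 0 < c -> 0 < a ->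
  {in `]0, +oo[, continuous f} -> {in `]0, +oo[, forall t, 0 <= f t} ->
  (\int[leb]_(t in `[(c * a)%R, +oo[) (f t)%:E =
   \int[leb]_(t in `[a, +oo[) (f (c * t) * c)%R%:E)%E.
Proof.
move=> c0 a0 cf f0.
have dF : derive1 ( *%R c) = cst c.
  apply/funext => t; rewrite derive1E.
  rewrite (_ : *%R c = c \*: id)//.
  rewrite deriveZ// derive_id; exact: mulr1.
have cF : continuous ( *%R c) by move=> t; exact: mulrl_continuous.
rewrite (@increasing_ge0_integration_by_substitutiony _ ( *%R c))//.
- by apply: eq_integral => t _; rewrite dF.
- by move=> s t _ _ st; rewrite ltr_pM2l.
- by rewrite dF => t _; exact: cst_continuous.
- by rewrite dF; exact: is_cvg_cst.
- by rewrite dF; exact: is_cvg_cst.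
- split; last by apply: cvg_at_right_filter; exact: cF.
  by move=> t _; apply: (@derivableZ _ _ _ id).
- apply/cvgryPge => A; near=> t; rewrite -ler_pdivrMl//.
- apply/continuous_within_itvcyP; split.
    move=> t; rewrite in_itv/= andbT => cat; apply: cf.
    by rewrite in_itv/= andbT (lt_trans _ cat)// mulr_gt0.
  by apply: cvg_at_right_filter; apply: cf; rewrite in_itv/= mulr_gt0.
- move=> t; rewrite in_itv/= andbT => cat; apply: f0.
  by rewrite in_itv/= andbT (lt_trans _ cat)// mulr_gt0.
Unshelve. all: by end_near. Qed.

Lemma integral_itv0y_scale (f : R -> R) (c : R) : 0 < c ->
  {in `]0, +oo[, continuous f} -> {in `]0, +oo[, forall t, 0 <= f t} ->
  (\int[leb]_(t in `]0%R, +oo[) (f (c * t) * c)%R%:E =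
   \int[leb]_(t in `]0%R, +oo[) (f t)%:E)%E.
Proof.
move=> c0 cf f0.
have sub0y (a : R) : 0 < a -> `[a, +oo[%classic `<=` `]0, +oo[%classic.
  by move=> a0 t/=; rewrite !in_itv/= !andbT; exact: lt_le_trans.
have c0y t : t \in `]0, +oo[ -> c * t \in `]0, +oo[.
  by rewrite !in_itv/= !andbT => t0; rewrite mulr_gt0.
have mf : measurable_fun (`]0, +oo[%classic : set R) f.
  apply: open_continuous_measurable_fun; first exact: interval_open.
  by move=> t; rewrite inE => t0; exact: cf.
have mg : measurable_fun (`]0, +oo[%classic : set R) (fun t => f (c * t) * c).
  apply: measurable_funM => //.
  apply: open_continuous_measurable_fun; first exact: interval_open.
  move=> t; rewrite inE => t0; apply: (@continuous_comp _ _ _ ( *%R c) f).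
    exact: mulrl_continuous.
  by apply: cf; exact: c0y.
have g0 : {in `]0, +oo[, forall t, 0 <= f (c * t) * c}.
  by move=> t /c0y/f0 ?; rewrite mulr_ge0// ltW.
apply/eqP; rewrite eq_le; apply/andP; split.
- apply: integral_itv0y_le => // a a0; rewrite -integral_itvcy_scale//.
  apply: ge0_subset_integral => //=; first exact/measurable_EFinP.
  by apply: sub0y; rewrite mulr_gt0.
- apply: integral_itv0y_le => // a a0.
  have -> : a = c * (a / c) by rewrite mulrC divfK// gt_eqF.
  have ac0 : 0 < a / c by rewrite divr_gt0.
  rewrite integral_itvcy_scale//.
  by apply: ge0_subset_integral => //=; [exact/measurable_EFinP|exact: sub0y].
Qed.

End half_line.

(** * The Gamma function *)

Section Gamma_theory.
Variable R : realType.
Local Notation leb := (@lebesgue_measure R).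

Definition gamma_integrand (s t : R) : R := t `^ (s - 1) * expR (- t).

Lemma gamma_integrand_ge0 s t : 0 <= gamma_integrand s t.
Proof. by rewrite mulr_ge0 ?powR_ge0 ?expR_ge0. Qed.

Lemma continuous_powR (p t : R) : 0 < t -> {for t, continuous (@powR R ^~ p)}.
Proof.
move=> t0; apply/differentiable_continuous/derivable1_diffP.
by apply: derivable_powR; rewrite in_itv/= t0.
Qed.

Lemma continuous_gamma_integrand s :
  {in `]0, +oo[, continuous (gamma_integrand s)}.
Proof.
move=> t; rewrite in_itv/= andbT => t0; apply: cvgM; first exact: continuous_powR.
apply: (@continuous_comp _ _ _ -%R expR); first exact: opp_continuous.
exact: continuous_expR.
Qed.

Lemma measurable_gamma_integrand s : measurable_fun setT (gamma_integrand s).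
Proof.
apply: measurable_funM; first exact: measurable_powR.
by apply: measurableT_comp => //; exact: measurable_expR.
Qed.

(** Raise 1 + t <= p (1 + t / p) <= p e^(t/p) to the power p. *)
Lemma powR_le_expR (p t : R) : 1 <= p -> 0 <= t ->
  (1 + t) `^ p <= p `^ p * expR t.
Proof.
move=> p1 t0; have p0 : 0 < p by rewrite (lt_le_trans _ p1).
have -> : expR t = expR (t / p) `^ p.
  by rewrite -expRM divfK// gt_eqF.
rewrite -powRM ?expR_ge0 ?(ltW p0)// ge0_ler_powR ?nnegrE ?(ltW p0)//.
- by rewrite addr_ge0.
- by rewrite mulr_ge0 ?expR_ge0// ltW.
- apply: le_trans (_ : p * (1 + t / p) <= _).
    by rewrite mulrDr mulr1 mulrCA divff ?gt_eqF// mulr1 lerD2r.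
  by rewrite ler_pM2l// expR_ge1Dx.
Qed.

Lemma gt0_mulr_powRB1 (p t : R) : 0 < t -> t * t `^ (p - 1) = t `^ p.
Proof.
move=> t0; rewrite -[X in X * _](powRr1 (ltW t0)) -powRD.
  by rewrite addrC subrK.
by rewrite (gt_eqF t0) implybT.
Qed.

Lemma is_derive_powR_ratio (s t : R) : 0 < t ->
  is_derive t 1 (fun u : R => u `^ s * (1 + u) `^ (- s))
    (s * (t `^ (s - 1) * (1 + t) `^ (- (s + 1)))).
Proof.
move=> t0; have t10 : 0 < 1 + t by rewrite addr_gt0.
have d1 : is_derive t 1 (fun u : R => 1 + u) 1.
  rewrite -[X in is_derive _ _ _ X]add0r.
  exact: (is_deriveD (is_derive_cst (1 : R) (t : R) (1 : R))
    (is_derive_id (t : R) (1 : R))).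
have d2 : is_derive t 1 (fun u : R => (1 + u) `^ (- s))
    (- s * (1 + t) `^ (- s - 1)).
  have := @is_derive1_comp _ (fun x => x `^ (- s)) (fun u => 1 + u) t _ _
    (is_derive1_powR (- s) t10) d1.
  by rewrite mulr1.
apply: (is_derive_eq (is_deriveM (is_derive1_powR s t0) d2)).
rewrite -(gt0_mulr_powRB1 s t0) -(gt0_mulr_powRB1 (- s) t10).
by rewrite opprD !/GRing.scale /=; ring.
Qed.

Lemma powR_ratio_cvg1 (s : R) :
  (fun u : R => u `^ s * (1 + u) `^ (- s)) u @[u --> +oo%R] --> (1 : R).
Proof.
have : ((1 + u^-1) `^ (- s)) @[u --> +oo%R] --> (1 : R).
  have : (1 + u^-1) @[u --> +oo%R] --> (1 + 0 : R).
    apply: cvgD; [exact: cvg_cst|apply/gtr0_cvgV0; last exact: cvg_id].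
    exact: nbhs_pinfty_gt.
  rewrite addr0.
  have /continuous_cvg : {for (1 : R), continuous (@powR R ^~ (- s))}.
    exact: continuous_powR.
  by move=> /[apply]; rewrite /= powR1.
apply: cvg_trans; apply: near_eq_cvg; near=> u.
have u0 : 0 < u by [].
have -> : 1 + u = u * (1 + u^-1).
  by rewrite mulrDr mulr1 divff ?gt_eqF// addrC.
rewrite powRM ?ltW//; last by rewrite addr_gt0 ?invr_gt0.
rewrite mulrA -powRD; last by rewrite (gt_eqF u0) implybT.
by rewrite subrr powRr0 mul1r.
Unshelve. all: by end_near. Qed.

(** The integrand is the derivative of (t / (1 + t))^s / s, which increases
    from 0 to 1 / s. *)
Lemma integral_powR_ratio_le (s a : R) : 0 < s -> 0 < a ->
  (\int[leb]_(t in `[a, +oo[) (t `^ (s - 1) * (1 + t) `^ (- (s + 1)))%R%:E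
     <= s^-1%:E)%E.
Proof.
move=> s0 a0.
pose G (u : R) : R := s^-1 * (u `^ s * (1 + u) `^ (- s)).
have dG (t : R) : 0 < t -> is_derive t 1 G (t `^ (s - 1) * (1 + t) `^ (- (s + 1))).
  move=> t0; apply: (is_derive_eq (is_deriveZ s^-1 (is_derive_powR_ratio s t0))).
  by rewrite /GRing.scale/= mulKf// gt_eqF.
have cf : {in `]0, +oo[,
    continuous (fun t : R => t `^ (s - 1) * (1 + t) `^ (- (s + 1)))}.
  move=> t; rewrite in_itv/= andbT => t0.
  apply: cvgM; first exact: continuous_powR.
  apply: (@continuous_comp _ _ _ (fun u : R => 1 + u)
    (fun x : R => x `^ (- (s + 1)))).
    by apply: cvgD; [exact: cvg_cst|exact: cvg_id].
  by apply: continuous_powR; rewrite addr_gt0.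
rewrite (@ge0_continuous_FTC2y _ _ G a s^-1).
- by rewrite -EFinB lee_fin gerBl !mulr_ge0 ?powR_ge0 ?invr_ge0 ?ltW.
- by move=> t _; rewrite mulr_ge0 ?powR_ge0.
- apply/continuous_within_itvcyP; split.
    move=> t; rewrite in_itv/= andbT => at_; apply: cf.
    by rewrite in_itv/= andbT (lt_trans a0).
  by apply: cvg_at_right_filter; apply: cf; rewrite in_itv/= a0.
- rewrite -[X in _ --> X]mulr1; apply: cvgM; first exact: cvg_cst.
  exact: powR_ratio_cvg1.
- by move=> t at_; have [] := dG t (lt_trans a0 at_).
- apply: cvg_at_right_filter; apply/differentiable_continuous/derivable1_diffP.
  by have [] := dG a a0.
- move=> t; rewrite in_itv/= andbT => at_; rewrite derive1E.
  by have [_ ->] := dG t (lt_trans a0 at_).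
Qed.

(** Up to a constant the integrand is dominated by t^(s-1) (1 + t)^(-s-1),
    which behaves like it at 0, is integrable at infinity, and has an explicit
    bounded primitive. *)
Lemma integral_gamma_lty (s : R) : 0 < s ->
  (\int[leb]_(t in `]0%R, +oo[) (gamma_integrand s t)%:E < +oo)%E.
Proof.
move=> s0; set p := s + 1; have p1 : 1 <= p by rewrite lerDr ltW.
suff : (\int[leb]_(t in `]0%R, +oo[) (gamma_integrand s t)%:E
    <= (p `^ p * s^-1)%:E)%E by move=> /le_lt_trans; apply; exact: ltry.
have mg : measurable_fun setT (fun t : R => t `^ (s - 1) * (1 + t) `^ (- p)).
  apply: measurable_funM; first exact: measurable_powR.
  apply: (@measurableT_comp _ _ _ _ _ _ (fun x : R => x `^ (- p))).
    exact: measurable_powR.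
  exact: measurable_funD.
apply: integral_itv0y_le.
- exact: measurable_funS (measurable_gamma_integrand s).
- by move=> t _; exact: gamma_integrand_ge0.
move=> a a0; rewrite EFinM.
have pp0 : 0 <= p `^ p by exact: powR_ge0.
apply: (@le_trans _ _ (\int[leb]_(t in `[a, +oo[)
    ((p `^ p)%:E * (t `^ (s - 1) * (1 + t) `^ (- p))%R%:E))%E); last first.
  rewrite ge0_integralZl//.
  - by rewrite lee_wpmul2l// ?lee_fin// integral_powR_ratio_le.
  - by apply/measurable_EFinP; exact: measurable_funS mg.
  - by move=> t _; rewrite lee_fin mulr_ge0 ?powR_ge0.
apply: ge0_le_integral => //.
- by move=> t _; rewrite lee_fin gamma_integrand_ge0.
- by apply/measurable_EFinP; exact: measurable_funS (measurable_gamma_integrand s).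
- by apply/measurable_EFinP/measurable_funM => //; exact: measurable_funS mg.
move=> t /=; rewrite in_itv/= andbT => at_.
have t0 : 0 < t by exact: lt_le_trans at_.
have t10 : 0 < 1 + t by rewrite addr_gt0.
rewrite lee_fin mulrCA ler_wpM2l ?powR_ge0// powRN expRN.
rewrite ler_pdivlMr ?powR_gt0// mulrC ler_pdivrMr ?expR_gt0//.
by rewrite powR_le_expR// ltW.
Qed.

(** Gamma is defined through a real-valued integral, which would be 0 if the
    integral were infinite; this is where finiteness matters. *)
Lemma GammaE (s : R) : 0 < s ->
  ((Gamma s)%:E = \int[leb]_(t in `]0%R, +oo[) (gamma_integrand s t)%:E)%E.
Proof.
move=> s0; rewrite /Gamma /Rintegral fineK// ge0_fin_numE ?integral_gamma_lty//.
by apply: integral_ge0 => t _; rewrite lee_fin gamma_integrand_ge0.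
Qed.

Lemma Gamma_gt0 (s : R) : 0 < s -> 0 < Gamma s.
Proof.
move=> s0; rewrite -lte_fin GammaE//.
(* On [1, 2] both e^(-t) >= e^(-2) and t^(s-1) = t^s / t >= 1 / 2. *)
have c0 : 0 < expR (- 2) / 2 :> R by rewrite divr_gt0 ?expR_gt0.
apply: (@lt_le_trans _ _ (\int[leb]_(t in `[1%R, 2%R]) (expR (- 2) / 2)%:E)%E).
  rewrite integral_cst//= lebesgue_measure_itv/= lte_fin ltr1n.
  by rewrite -EFinD -EFinM lte_fin mulr_gt0// subr_gt0 ltr1n.
apply: (@le_trans _ _ (\int[leb]_(t in `[1%R, 2%R]) (gamma_integrand s t)%:E)%E).
  apply: ge0_le_integral => //.
  - by apply/measurable_EFinP; exact: measurable_funS (measurable_gamma_integrand s).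
  move=> t /=; rewrite in_itv/= => /andP[t1 t2].
  have t0 : 0 < t by exact: lt_le_trans t1.
  rewrite lee_fin mulrC ler_pM ?invr_ge0 ?expR_ge0//; last by rewrite ler_expR lerN2.
  rewrite -(ler_pM2l t0) gt0_mulr_powRB1//.
  apply: (@le_trans _ _ 1); first by rewrite ler_pdivrMr ?mul1r.
  by rewrite -(powRr0 t) ler_powR// ltW.
apply: ge0_subset_integral => //=.
- by apply/measurable_EFinP; exact: measurable_funS (measurable_gamma_integrand s).
- by move=> t _; rewrite lee_fin gamma_integrand_ge0.
- by move=> t /=; rewrite !in_itv/= andbT => /andP[t1 _]; exact: lt_le_trans t1.
Qed.

Lemma integral_gamma_scale (s c : R) : 0 < s -> 0 < c ->
  (\int[leb]_(t in `]0%R, +oo[) (t `^ (s - 1) * expR (- (c * t)))%R%:E =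
   (c `^ (- s) * Gamma s)%:E)%E.
Proof.
move=> s0 c0; rewrite EFinM GammaE//.
rewrite -(integral_itv0y_scale c0 (@continuous_gamma_integrand s)); last first.
  by move=> t _; exact: gamma_integrand_ge0.
have cs0 : 0 <= c `^ (- s) by exact: powR_ge0.
rewrite -ge0_integralZl//; last 2 first.
- apply/measurable_EFinP/measurable_funM => //.
  apply: (measurable_funS measurableT) => //.
  apply: (measurableT_comp (measurable_gamma_integrand s)).
  exact: measurable_funM.
- move=> t _; rewrite lee_fin mulr_ge0 ?gamma_integrand_ge0//; exact: ltW.
apply: eq_integral => t; rewrite inE/= in_itv/= andbT => t0.
rewrite -EFinM; congr EFin; rewrite /gamma_integrand powRM ?(ltW c0) ?(ltW t0)//.
have -> : c `^ (s - 1) = c `^ s / c.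
  by rewrite -(gt0_mulr_powRB1 s c0) mulrC mulKf// gt_eqF.
rewrite powRN; have : c `^ s != 0 by rewrite gt_eqF ?powR_gt0.
by have := gt_eqF c0; move=> /negbT ? ?; field; apply/andP.
Qed.

End Gamma_theory.

(** * Powers of the distance to a point *)

Section dist_integral.
Variable R : realType.
Local Notation leb := (@lebesgue_measure R).
Local Notation borelR := (g_sigma_algebraType R.-ocitv.-measurable).

(** Up to its normalization the integrand is the normal density with mean m
    and variance 1 / (2 t). *)
Lemma integral_gauss (t m : R) : 0 < t ->
  (\int[leb]_s (expR (- (t * (s - m) ^+ 2)))%:E = (Num.sqrt (pi / t))%:E)%E.
Proof.
move=> t0; pose sg : R := Num.sqrt (t^-1 / 2).
have sg2 : sg ^+ 2 = t^-1 / 2 by rewrite sqr_sqrtr// divr_ge0// invr_ge0 ltW.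
have sg0 : sg != 0.
  by rewrite gt_eqF// sqrtr_gt0 divr_gt0// invr_gt0.
have pk0 := normal_peak_gt0 sg0.
have E s : normal_pdf m sg s = normal_peak sg * expR (- (t * (s - m) ^+ 2)).
  rewrite normal_pdfE//; congr (_ * expR _); rewrite sg2 mulNr; congr (- _).
  by field; rewrite gt_eqF.
have := integral_normal_pdf m sg.
under eq_integral do rewrite E EFinM.
rewrite ge0_integralZl//; first last.
- by rewrite lee_fin ltW.
- apply/measurable_EFinP; apply: measurableT_comp => //.
  apply: measurable_funN; apply: measurable_funM => //.
  by apply: measurable_funX; exact: measurable_funB.
move=> /(congr1 (fun x => (normal_peak sg)^-1%:E * x)%E).
rewrite muleA -EFinM mulVf ?gt_eqF// mul1e mule1 => ->.
congr EFin; rewrite /normal_peak invrK; congr Num.sqrt; rewrite sg2.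
by field; rewrite gt_eqF.
Qed.

Definition sqdist d (m : 'I_d -> R) (y : d.-tuple R) : R :=
  \sum_i (tnth y i - m i) ^+ 2.

Lemma sqdist_ge0 d (m : 'I_d -> R) y : 0 <= sqdist m y.
Proof. by apply: sumr_ge0 => i _; exact: sqr_ge0. Qed.

Lemma measurable_sqdist d (m : 'I_d -> R) :
  measurable_fun [set: d.-tuple R] (sqdist m).
Proof.
apply: measurable_sum => i; apply: measurable_funX; apply: measurable_funB => //.
exact: measurable_tnth.
Qed.

Lemma integral_gauss_tuple d (m : 'I_d -> R) (t : R) : 0 < t ->
  (\int[lebesgue_tuple R d]_y (expR (- (t * sqdist m y)))%:E =
   (pi `^ (d%:R / 2) * t `^ (- (d%:R / 2)))%:E)%E.
Proof.
move=> t0.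
under eq_integral.
  move=> y _; rewrite /sqdist mulr_sumr -sumrN expR_sum.
  over.
rewrite (@integral_lebesgue_tuple_prod _ _ (fun i s => expR (- (t * (s - m i) ^+ 2)))
  (fun i => Num.sqrt (pi / t))).
- congr EFin; rewrite prodr_const card_ord -powR12_sqrt; last first.
    by rewrite divr_ge0 ?pi_ge0// ltW.
  rewrite -powR_mulrn ?powR_ge0// -powRrM mulrC powRM ?pi_ge0 ?invr_ge0 ?(ltW t0)//.
  by rewrite mulrC -(powR_inv1 (ltW t0)) -powRrM mulN1r (mulrC 2^-1).
- move=> i; apply: measurableT_comp => //.
  apply: measurable_funN; apply: measurable_funM => //.
  by apply: measurable_funX; exact: measurable_funB.
- by move=> i s; exact: expR_ge0.
- by move=> i; exact: integral_gauss.
Qed.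

(** Since Gamma(s) q^(-s) = int t^(s-1) e^(-q t) dt, exchanging the integrals
    leaves a Gaussian integral in y, worth pi^(d/2) t^(-d/2); the remaining
    integral in t is again a Gamma integral, with parameter s - d/2. *)
Lemma integral_powR_sqdist d (m : 'I_d -> R) (b sg : R) :
  0 < b -> d%:R / 2 < sg ->
  (\int[lebesgue_tuple R d]_y ((b + sqdist m y) `^ (- sg))%:E =
   (pi `^ (d%:R / 2) * Gamma (sg - d%:R / 2) / Gamma sg
     * b `^ (- (sg - d%:R / 2)))%:E)%E.
Proof.
move=> b0 dsg.
have sg0 : 0 < sg by rewrite (le_lt_trans _ dsg).
have sgd0 : 0 < sg - d%:R / 2 by rewrite subr_gt0.
have bq0 y : 0 < b + sqdist m y by rewrite ltr_wpDr// sqdist_ge0.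
have G0 := Gamma_gt0 sg0.
pose mu := sigma_finite_of (@sigma_finite_lebesgue_tuple R d).
pose D : set borelR := `]0, +oo[%classic.
have mD : measurable D by exact: measurable_itv.
pose F (z : d.-tuple R * borelR) : \bar R :=
  ((z.2 : R) `^ (sg - 1) * expR (- ((b + sqdist m z.1) * z.2)) * \1_D z.2)%:E.
have F0 z : (0 <= F z)%E.
  by rewrite lee_fin !mulr_ge0 ?powR_ge0 ?expR_ge0.
have mF : measurable_fun setT F.
  apply/measurable_EFinP; apply: measurable_funM; last first.
    have mI : measurable_fun [set: borelR] (\1_D : borelR -> R) by [].
    exact: (measurableT_comp mI (@measurable_snd _ _ (d.-tuple R) borelR)).
  have m2 : measurable_fun [set: d.-tuple R * borelR] (fun z => z.2 : R).
    exact: measurable_snd.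
  apply: measurable_funM.
    exact: (measurableT_comp (@measurable_powR R (sg - 1)) m2).
  apply: (measurableT_comp (@measurable_expR R)); apply: measurable_funN.
  apply: measurable_funM => //; apply: measurable_funD => //.
  by apply: (measurableT_comp (measurable_sqdist m)); exact: measurable_fst.
have FE y t : D t ->
    F (y, t) = (t `^ (sg - 1) * expR (- ((b + sqdist m y) * t)))%:E.
  by move=> Dt; rewrite /F/= indicE mem_set// mulr1.
have F00 y t : ~ D t -> F (y, t) = 0%E.
  by move=> Dt; rewrite /F/= indicE memNset// mulr0.
have inner1 y : (\int[leb]_t F (y, t) =
    (Gamma sg)%:E * ((b + sqdist m y) `^ (- sg))%:E)%E.
  rewrite muleC -EFinM -integral_gamma_scale// [RHS]integral_mkcond.
  apply: eq_integral => t _; rewrite patchE; case: ifPn => [/set_mem|/negP] Dt.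
    exact: FE.
  by apply: F00; move/mem_set.
have inner2 t : (\int[mu]_y F (y, t) = ((fun t : R => (pi `^ (d%:R / 2))%:E *
    (t `^ (sg - d%:R / 2 - 1) * expR (- (b * t)))%:E) \_ D) t)%E.
  rewrite patchE; case: ifPn => [/set_mem|/negP] Dt; last first.
    by apply: integral0_eq => y _; apply: F00; move/mem_set.
  have t0 : 0 < t by move: Dt; rewrite /D/= in_itv/= andbT.
  transitivity (\int[mu]_y ((t `^ (sg - 1) * expR (- (b * t)))%:E *
      (expR (- (t * sqdist m y)))%:E))%E.
    apply: eq_integral => y _.
    rewrite FE// -EFinM -mulrA -expRD; congr (_ * expR _)%:E.
    by ring.
  rewrite ge0_integralZl//; last 2 first.
  - apply/measurable_EFinP/(measurableT_comp (@measurable_expR R)).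
    by apply: measurable_funN; apply: measurable_funM => //; exact: measurable_sqdist.
  - by rewrite lee_fin mulr_ge0 ?powR_ge0 ?expR_ge0.
  rewrite (@integral_gauss_tuple d m t t0) -!EFinM; congr EFin.
  have -> : sg - d%:R / 2 - 1 = (sg - 1) - d%:R / 2 by ring.
  have -> : t `^ ((sg - 1) - d%:R / 2) = t `^ (sg - 1) * t `^ (- (d%:R / 2)).
    by apply: powRD; rewrite (gt_eqF t0) implybT.
  by ring.
have := @fubini_tonelli _ _ _ _ R mu leb F mF F0.
under eq_integral do rewrite inner1.
under [X in _ = X -> _]eq_integral do rewrite inner2.
rewrite ge0_integralZl//; last 3 first.
- apply/measurable_EFinP/(measurableT_comp (@measurable_powR R (- sg))).
  by apply: measurable_funD => //; exact: measurable_sqdist.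
- by move=> y _; rewrite lee_fin powR_ge0.
- by rewrite lee_fin ltW.
rewrite -integral_mkcond.
rewrite ge0_integralZl//; last 3 first.
- apply/measurable_EFinP/(measurable_funS measurableT) => //.
  apply: measurable_funM; first exact: measurable_powR.
  apply: (measurableT_comp (@measurable_expR R)).
  by apply: measurable_funN; apply: measurable_funM.
- by move=> t _; rewrite lee_fin mulr_ge0 ?powR_ge0 ?expR_ge0.
- by rewrite lee_fin powR_ge0.
rewrite integral_gamma_scale//.
move=> /(congr1 (fun x => (Gamma sg)^-1%:E * x)%E).
rewrite muleA -EFinM mulVf ?gt_eqF// mul1e => ->.
by rewrite -!EFinM; congr EFin; field; rewrite gt_eqF.
Qed.

End dist_integral.

(** * Euclidean geometry of row vectors *)

Section euclidean.
Variables (R : realType) (n : nat).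
Implicit Types v w z : 'rV[R]_n.

Definition dot v w : R := \sum_i v 0 i * w 0 i.

Lemma dotC v w : dot v w = dot w v.
Proof. by apply: eq_bigr => i _; rewrite mulrC. Qed.

Lemma dotDl v w z : dot (v + w) z = dot v z + dot w z.
Proof. by rewrite /dot -big_split; apply: eq_bigr => i _; rewrite mxE mulrDl. Qed.

Lemma dotZl (c : R) v w : dot (c *: v) w = c * dot v w.
Proof. by rewrite /dot mulr_sumr; apply: eq_bigr => i _; rewrite mxE mulrA. Qed.

Lemma dot_delta i v : dot (delta_mx 0 i) v = v 0 i.
Proof.
rewrite /dot (bigD1 i)//= mxE !eqxx mul1r big1 ?addr0// => j ji.
by rewrite mxE eqxx (negPf ji) mul0r.
Qed.

Lemma enorm_ge0 v : 0 <= enorm v.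
Proof. exact: sqrtr_ge0. Qed.

Lemma enorm_sqr v : enorm v ^+ 2 = dot v v.
Proof. by rewrite sqr_sqrtr ?sumr_ge0// => i _; exact: sqr_ge0. Qed.

(** With a = w . w and b = v . w, the sum of the squares of the coordinates of
    a v - b w is a (a (v . v) - b^2). *)
Lemma cauchy_schwarz v w : dot v w ^+ 2 <= dot v v * dot w w.
Proof.
set a := dot w w; set b := dot v w.
have a0 : 0 <= a by apply: sumr_ge0 => i _; rewrite -expr2 sqr_ge0.
have : 0 <= a * (dot v v * a - b ^+ 2).
  have -> : a * (dot v v * a - b ^+ 2) = \sum_i (a * v 0 i - b * w 0 i) ^+ 2.
    transitivity (\sum_i (a ^+ 2 * (v 0 i * v 0 i)
        + (- (2 * a * b) * (v 0 i * w 0 i) + b ^+ 2 * (w 0 i * w 0 i)))).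
      rewrite !big_split -!mulr_sumr/= -/(dot v v) -/(dot v w) -/(dot w w) -/a -/b.
      by ring.
    by apply: eq_bigr => i _; ring.
  by apply: sumr_ge0 => i _; exact: sqr_ge0.
have [a_eq0 _|a1] := eqVneq a 0; last first.
  by rewrite pmulr_rge0 ?subr_ge0// lt_def a1.
suff -> : b = 0 by rewrite expr0n a_eq0 mulr0.
rewrite /b /dot big1// => i _; suff /eqP -> : w 0 i == 0 by rewrite mulr0.
rewrite -sqrf_eq0 expr2; apply/eqP.
apply: (psumr_eq0P (P := xpredT) (F := fun i => w 0 i * w 0 i)) => // j _.
by rewrite -expr2 sqr_ge0.
Qed.

Lemma norm_le_enorm v i : `|v 0 i| <= enorm v.
Proof.
rewrite -(ler_pXn2r (ltn0Sn 1)) ?nnegrE ?enorm_ge0// enorm_sqr real_normK ?num_real//.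
rewrite /dot (bigD1 i)//= -expr2 lerDl sumr_ge0// => j _; rewrite -expr2.
exact: sqr_ge0.
Qed.

Definition norm1 v : R := \sum_i `|v 0 i|.

Lemma norm_dot_le v w : `|dot v w| <= enorm v * norm1 w.
Proof.
rewrite mulr_sumr; apply: le_trans (ler_norm_sum _ _ _) _; apply: ler_sum => i _.
by rewrite normrM ler_wpM2r// norm_le_enorm.
Qed.

Lemma dot_le_norm1_sqr v : dot v v <= norm1 v ^+ 2.
Proof.
rewrite expr2 {1}/norm1 mulr_suml; apply: ler_sum => i _.
rewrite (le_trans (ler_norm _))// normrM ler_wpM2l//.
by rewrite /norm1 (bigD1 i)//= lerDl sumr_ge0.
Qed.

End euclidean.

(** * The kernel and its directional derivatives *)

Section kernel.
Variables (R : realType) (d : nat).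
Implicit Types (x v z : 'rV[R]_d.+1) (y : d.-tuple R).

Definition sight x y : 'rV[R]_d.+1 := boundary_point y - x.

Definition kernel (beta : R) x y : R :=
  (x 0 ord_max / enorm (sight x y)) `^ beta.

Lemma sight_last x y : sight x y 0 ord_max = - x 0 ord_max.
Proof. by rewrite !mxE nth_default ?size_tuple// sub0r. Qed.

Lemma sight_sqr x y : dot (sight x y) (sight x y) =
  x 0 ord_max ^+ 2 + sqdist (fun i : 'I_d => x 0 (widen_ord (leqnSn d) i)) y.
Proof.
rewrite /dot big_ord_recr/= sight_last mulrNN addrC; congr (_ + _).
by apply: eq_bigr => i _; rewrite !mxE (tnth_nth 0).
Qed.

Lemma sight_sqr_gt0 x y : half_space x -> 0 < dot (sight x y) (sight x y).
Proof.
by move=> x0; rewrite sight_sqr ltr_wpDr ?sqdist_ge0// exprn_gt0.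
Qed.

Lemma enorm_sight_gt0 x y : half_space x -> 0 < enorm (sight x y).
Proof. by move=> x0; rewrite sqrtr_gt0; exact: sight_sqr_gt0. Qed.

Lemma last_le_enorm_sight x y : half_space x -> x 0 ord_max <= enorm (sight x y).
Proof.
move=> x0; rewrite -(ler_pXn2r (ltn0Sn 1)) ?nnegrE ?enorm_ge0 ?(ltW x0)//.
by rewrite enorm_sqr sight_sqr lerDl sqdist_ge0.
Qed.

Lemma kernelE beta x y : half_space x -> kernel beta x y =
  x 0 ord_max `^ beta * dot (sight x y) (sight x y) `^ (- (beta / 2)).
Proof.
move=> x0; rewrite /kernel powRM ?invr_ge0 ?enorm_ge0 ?(ltW x0)//; congr (_ * _).
rewrite -enorm_sqr -powR_inv1 ?enorm_ge0// -powR_mulrn ?enorm_ge0//.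
by rewrite -!powRrM; congr powR; field.
Qed.

Lemma kernel_ge0 beta x y : 0 <= kernel beta x y.
Proof. exact: powR_ge0. Qed.

Lemma measurable_boundary_point i :
  measurable_fun [set: d.-tuple R] (fun y => boundary_point y 0 i).
Proof.
case: (unliftP ord_max i) => [j|] ->.
  rewrite (_ : (fun _ => _) = (@tnth _ R ^~ j)); first exact: measurable_tnth.
  by apply/funext => y; rewrite mxE lift_max (tnth_nth 0).
rewrite (_ : (fun _ => _) = cst 0)//.
by apply/funext => y; rewrite mxE nth_default ?size_tuple.
Qed.

Lemma measurable_sight_dot x v :
  measurable_fun [set: d.-tuple R] (fun y => dot (sight x y) v).
Proof.
apply: measurable_sum => i; apply: measurable_funM => //.
rewrite (_ : (fun _ => _) = (fun y => boundary_point y 0 i - x 0 i)); last first.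
  by apply/funext => y; rewrite !mxE.
by apply: measurable_funB => //; exact: measurable_boundary_point.
Qed.

Lemma measurable_sight_sqr x :
  measurable_fun [set: d.-tuple R] (fun y => dot (sight x y) (sight x y)).
Proof.
under eq_fun do rewrite sight_sqr.
by apply: measurable_funD => //; exact: measurable_sqdist.
Qed.

Lemma measurable_kernel beta x : half_space x ->
  measurable_fun [set: d.-tuple R] (kernel beta x).
Proof.
move=> x0; rewrite (_ : kernel beta x = fun y => x 0 ord_max `^ beta *
    dot (sight x y) (sight x y) `^ (- (beta / 2))); last first.
  by apply/funext => y; rewrite kernelE.
apply: measurable_funM => //.
apply: (measurableT_comp (@measurable_powR R _)).
exact: measurable_sight_sqr.
Qed.

(** The integral of the kernel at height x_n = 1. *)
Definition kernel_mass (beta : R) : R :=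
  pi `^ (d%:R / 2) * Gamma ((beta - d%:R) / 2) / Gamma (beta / 2).

Lemma integral_kernel beta x : d%:R < beta -> half_space x ->
  (\int[lebesgue_tuple R d]_y (kernel beta x y)%:E =
   (kernel_mass beta * x 0 ord_max ^+ d)%:E)%E.
Proof.
move=> dbeta x0; have x0' : 0 < x 0 ord_max by [].
under eq_integral do rewrite kernelE// sight_sqr EFinM.
rewrite ge0_integralZl//; last 3 first.
- apply/measurable_EFinP/(measurableT_comp (@measurable_powR R _)).
  by apply: measurable_funD => //; exact: measurable_sqdist.
- by move=> y _; rewrite lee_fin powR_ge0.
- by rewrite lee_fin powR_ge0.
rewrite integral_powR_sqdist; last 2 first.
- by rewrite exprn_gt0.
- by rewrite ltr_pM2r.
rewrite -EFinM; congr EFin; rewrite /kernel_mass.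
have -> : beta / 2 - d%:R / 2 = (beta - d%:R) / 2 by field.
rewrite mulrCA; congr (_ * _).
rewrite -!(powR_mulrn _ (ltW x0')) -powRrM -powRD; last first.
  by rewrite (gt_eqF x0') implybT.
by congr powR; field.
Qed.

(** The derivative at x of ln (x_n / |w|) in the direction v, where w is
    sight x y. *)
Definition kernel_slope x v y : R :=
  v 0 ord_max / x 0 ord_max
  + dot (sight x y) v / dot (sight x y) (sight x y).

Lemma is_derive_affine (a b h : R) : is_derive h 1 (fun t => t * a + b) a.
Proof.
have da : is_derive h 1 (fun t : R => t * a) a.
  apply: (is_derive_eq (is_deriveM (is_derive_id (h : R) (1 : R))
    (is_derive_cst a (h : R) (1 : R)))).
  by rewrite /GRing.scale/= mulr0 add0r mulr1.
rewrite -[X in is_derive _ _ _ X]addr0.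
exact: (is_deriveD da (is_derive_cst b (h : R) (1 : R))).
Qed.

Lemma is_derive_kernel beta x v y (h : R) : half_space (h *: v + x) ->
  is_derive h 1 (fun h => kernel beta (h *: v + x) y)
    (beta * kernel beta (h *: v + x) y * kernel_slope (h *: v + x) v y).
Proof.
move=> xh0.
have xh0' : 0 < h * v 0 ord_max + x 0 ord_max.
  by move: xh0; rewrite /half_space/= !mxE.
have Q0 := sight_sqr_gt0 y xh0.
set b := boundary_point y.
pose X (t : R) : R := t * v 0 ord_max + x 0 ord_max.
pose Q (t : R) : R := \sum_i (b 0 i - (t * v 0 i + x 0 i)) ^+ 2.
have QE t : dot (sight (t *: v + x) y) (sight (t *: v + x) y) = Q t.
  by apply: eq_bigr => i _; rewrite -expr2 !mxE.
have XE t : (t *: v + x) 0 ord_max = X t by rewrite !mxE.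
have dX : is_derive h 1 X (v 0 ord_max) by exact: is_derive_affine.
have dQ : is_derive h 1 Q (- 2 * dot (sight (h *: v + x) y) v).
  have -> : Q = \sum_i (fun t => (b 0 i - (t * v 0 i + x 0 i)) ^+ 2).
    by apply/funext => t; rewrite fct_sumE.
  rewrite /dot mulr_sumr; apply: is_derive_sum => i.
  have dl : is_derive h 1 (fun t => b 0 i - (t * v 0 i + x 0 i)) (0 - v 0 i).
    exact: (is_deriveB (is_derive_cst (b 0 i) (h : R) (1 : R))
      (is_derive_affine _ _ _)).
  apply: (is_derive_eq (is_deriveX 2 dl)).
  by rewrite /GRing.scale/= expr1 !mxE; ring.
have dXb := @is_derive1_comp _ (fun t => t `^ beta) X h _ _
  (is_derive1_powR beta xh0') dX.
rewrite QE in Q0.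
have dQb := @is_derive1_comp _ (fun t => t `^ (- (beta / 2))) Q h _ _
  (is_derive1_powR (- (beta / 2)) Q0) dQ.
apply: (@near_eq_is_derive _ _ _
  (((fun t => t `^ beta) \o X) * ((fun t => t `^ (- (beta / 2))) \o Q))).
- have cX : {for h, continuous X}.
    by apply/differentiable_continuous/derivable1_diffP; case: dX.
  near=> t; have Xt : 0 < X t by near: t; exact: (cvgr_gt (X h) cX).
  rewrite kernelE; first by rewrite XE QE.
  by rewrite /half_space/= XE.
- apply: (is_derive_eq (is_deriveM dXb dQb)).
  rewrite kernelE// XE QE /kernel_slope XE QE.
  set D := dot (sight _ y) v; rewrite /GRing.scale/= -/(X h).
  have XB := gt0_mulr_powRB1 beta xh0'; rewrite -/(X h) in XB xh0'.
  rewrite -XB -(gt0_mulr_powRB1 (- (beta / 2)) Q0).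
  by field; rewrite !gt_eqF.
Unshelve. all: by end_near. Qed.

Lemma kernel_slope_sum x z y :
  kernel_slope x z y = \sum_i z 0 i * kernel_slope x (delta_mx 0 i) y.
Proof.
under eq_bigr => i _ do
  rewrite /kernel_slope [dot _ (delta_mx _ _)]dotC dot_delta mulrDr.
rewrite big_split/=; congr (_ + _).
  rewrite (bigD1 ord_max)//= mxE !eqxx mul1r big1 ?addr0// => i /negPf imax.
  by rewrite mxE eqxx eq_sym imax mul0r mulr0.
rewrite /dot mulr_suml; apply: eq_bigr => i _.
by rewrite mulrCA mulrA.
Qed.

Lemma norm_kernel_slope_le x v y : half_space x ->
  `|kernel_slope x v y| <= 2 * norm1 v / x 0 ord_max.
Proof.
move=> x0; have x0' : 0 < x 0 ord_max by [].
set V := norm1 v; have r0 := enorm_sight_gt0 y x0.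
have V0 : 0 <= V by exact: sumr_ge0.
have vV : `|v 0 ord_max| <= V.
  by rewrite /V /norm1 (bigD1 ord_max)//= lerDl sumr_ge0.
rewrite mulr_natl mulrnAl mulr2n; apply: le_trans (ler_normD _ _) _; apply: lerD.
  by rewrite normrM normfV (gtr0_norm x0') ler_pM2r// invr_gt0.
rewrite -enorm_sqr normrM normfV (gtr0_norm (exprn_gt0 _ r0)).
rewrite ler_pdivrMr ?exprn_gt0//.
apply: le_trans (norm_dot_le _ _) _; rewrite -/V expr2 mulrA.
rewrite [leLHS]mulrC ler_wpM2r ?(ltW r0)// mulrAC ler_pdivlMr//.
by rewrite ler_wpM2l// last_le_enorm_sight.
Qed.

(** Thales: a * kernel_slope x z y is p . z, where p is the projection of e_n
    on the hyperplane normal to the line of sight w and a = x_n.  The vector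
    m = e_n + (2 a / |w|^2) w is e_n reflected in that hyperplane, so
    |m| = 1, p = (e_n + m) / 2, and |2 (p . z) - z_n| = |m . z| <= 1 by
    Cauchy-Schwarz.  Multiplying the two resulting bounds
    p . z <= (1 + z_n) / 2 and - p . z <= (1 - z_n) / 2 by 1 - z_n and
    1 + z_n gives the claim according to the sign of p . z.  Its interest is
    that the right-hand side is linear in the slope. *)
Lemma norm_kernel_slope_le_unit x z y : half_space x -> dot z z = 1 ->
  `|kernel_slope x z y| <=
  z 0 ord_max * kernel_slope x z y + (1 - z 0 ord_max ^+ 2) / (2 * x 0 ord_max).
Proof.
move=> x0 z1; have a0 : 0 < x 0 ord_max by [].
have N0 := sight_sqr_gt0 y x0.
rewrite /kernel_slope; set a := x 0 ord_max in a0 *.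
set w := sight x y in N0 *; set N := dot w w in N0 *; set zn := z 0 ord_max.
pose m : 'rV[R]_d.+1 := delta_mx 0 ord_max + (2 * a / N) *: w.
have dotml v : dot m v = v 0 ord_max + 2 * a / N * dot w v.
  by rewrite dotDl dotZl dot_delta.
have wn : w 0 ord_max = - a by exact: sight_last.
have mn : m 0 ord_max = 1 + 2 * a / N * w 0 ord_max.
  by rewrite -dot_delta dotC dotml dotC dot_delta mxE !eqxx.
have mm : dot m m = 1.
  rewrite dotml mn [dot w m]dotC dotml -/N wn; field.
  by rewrite gt_eqF.
have := cauchy_schwarz m z; rewrite mm z1 dotml mulr1 -/zn.
have := norm_le_enorm z ord_max; rewrite /enorm.
have -> : \sum_i z 0 i ^+ 2 = 1 by rewrite -z1; apply: eq_bigr => i _; rewrite expr2.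
rewrite sqrtr1 -/zn ler_norml => /andP[zn1 zn2].
set D := dot w z; set p := zn + a * (D / N).
have -> : zn + 2 * a / N * D = 2 * p - zn by rewrite /p; field; rewrite gt_eqF.
have -> : zn / a + D / N = p / a by rewrite /p; field; rewrite !gt_eqF.
move=> psq; have : `|2 * p - zn| <= 1.
  by rewrite -(ler_pXn2r (ltn0Sn 1)) ?nnegrE// expr1n real_normK ?num_real.
rewrite ler_norml => /andP[p1 p2].
rewrite normrM normfV (gtr0_norm a0).
have -> : zn * (p / a) + (1 - zn ^+ 2) / (2 * a) =
    (zn * p + (1 - zn ^+ 2) / 2) / a.
  by field; rewrite gt_eqF.
rewrite ler_pM2r ?invr_gt0// ler_norml; apply/andP; split; nra.
Qed.

Lemma half_space_shift x v (h : R) : half_space x ->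
  `|h| * norm1 v <= x 0 ord_max / 2 ->
  x 0 ord_max / 2 <= (h *: v + x) 0 ord_max <= 3 / 2 * x 0 ord_max.
Proof.
move=> x0 hV; have x0' : 0 < x 0 ord_max by [].
have : `|h * v 0 ord_max| <= x 0 ord_max / 2.
  rewrite normrM; apply: le_trans hV; rewrite ler_wpM2l//.
  by rewrite /norm1 (bigD1 ord_max)//= lerDl sumr_ge0.
by rewrite ler_norml !mxE => /andP[? ?]; apply/andP; split; lra.
Qed.

(** Moving x by at most x_n / 2 multiplies x_n by at most 3/2 and divides the
    distance to a boundary point by at most 2. *)
Lemma kernel_shift_le beta x v y (h : R) : half_space x -> 0 <= beta ->
  `|h| * norm1 v <= x 0 ord_max / 2 ->
  kernel beta (h *: v + x) y <= 3 `^ beta * kernel beta x y.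
Proof.
move=> x0 beta0 hV; have x0' : 0 < x 0 ord_max by [].
have /andP[xh1 xh2] := half_space_shift x0 hV.
have xh0 : half_space (h *: v + x) by apply: lt_le_trans xh1; rewrite divr_gt0.
have r0 := enorm_sight_gt0 y x0.
have rh0 := enorm_sight_gt0 y xh0.
rewrite -powRM//; last by rewrite divr_ge0 ?ltW.
rewrite ge0_ler_powR ?nnegrE//.
- by rewrite divr_ge0// ?ltW.
- by rewrite mulr_ge0// divr_ge0// ltW.
have rr : enorm (sight x y) <= 2 * enorm (sight (h *: v + x) y).
  rewrite -(ler_pXn2r (ltn0Sn 1)) ?nnegrE ?mulr_ge0 ?enorm_ge0// exprMn !enorm_sqr.
  (* Coordinatewise 2 s^2 <= 4 (s - t)^2 + 4 t^2, where s is a coordinate of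
     w and t the same one of h v; and 4 |h v|^2 <= x_n^2 <= |w|^2. *)
  have sE : sight (h *: v + x) y = sight x y - h *: v.
    by rewrite /sight opprD addrA addrAC.
  have hv : (2 * h) ^+ 2 * dot v v <= dot (sight x y) (sight x y).
    apply: (@le_trans _ _ (x 0 ord_max ^+ 2)); last first.
      by rewrite sight_sqr lerDl sqdist_ge0.
    apply: (@le_trans _ _ ((2 * (`|h| * norm1 v)) ^+ 2)).
      rewrite mulrA !(exprMn, real_normK) ?num_real// -exprMn.
      rewrite ler_wpM2l ?sqr_ge0//.
      exact: dot_le_norm1_sqr.
    have := normr_ge0 h; have : 0 <= norm1 v by exact: sumr_ge0.
    move=> V0 h0; rewrite ler_pXn2r ?nnegrE ?mulr_ge0 ?(ltW x0')//; lra.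
  suff : 2 * dot (sight x y) (sight x y) <= 2 ^+ 2 * dot (sight (h *: v + x) y)
      (sight (h *: v + x) y) + (2 * h) ^+ 2 * dot v v by lra.
  rewrite sE /dot !mulr_sumr -big_split/=; apply: ler_sum => i _.
  have -> : (sight x y - h *: v) 0 i = sight x y 0 i - h * v 0 i by rewrite !mxE.
  set a := sight x y 0 i; rewrite -subr_ge0; set c := (X in 0 <= X).
  suff -> : c = 2 * (a - 2 * (h * v 0 i)) ^+ 2 by rewrite mulr_ge0 ?sqr_ge0.
  by rewrite /c; ring.
rewrite ler_pdivrMr// mulrA mulrAC ler_pdivlMr//.
have := ler_wpM2r (ltW r0) xh2.
have := ler_wpM2l (ltW x0') rr.
lra.
Qed.

End kernel.

(** * Essentially bounded functions *)

Section Linfty_theory.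
Variables (R : realType) (d : nat).
Local Notation mu := (lebesgue_tuple R d).
Implicit Types (f g : d.-tuple R -> R) (x v : 'rV[R]_d.+1).

Lemma Linfty_measurable f : Linfty f -> measurable_fun [set: d.-tuple R] f.
Proof. by move=> /sub_Lfun_mfun/set_mem. Qed.

Lemma Linfty_norm_fin f : Linfty f -> Linfty_norm f \is a fin_num.
Proof.
move=> /sub_Lfun_finLfun/set_mem foo; rewrite ge0_fin_numE//.
exact: Lnorm_ge0.
Qed.

Lemma Linfty_ae_le f : Linfty f ->
  {ae mu, forall y, `|f y| <= fine (Linfty_norm f)}.
Proof.
move=> foo; have ff := Linfty_norm_fin foo.
have := ess_sup_ge mu (abse \o (EFin \o f)).
have -> : ess_sup mu (abse \o (EFin \o f)) = Linfty_norm f.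
  by rewrite /Linfty_norm unlock lebesgue_tuple_setT_gt0.
by apply: filterS => y; rewrite -[Linfty_norm f]fineK//= lee_fin.
Qed.

Lemma integrable_kernel_mul beta x (c : R) f g : d%:R < beta -> half_space x ->
  measurable_fun [set: d.-tuple R] g -> 0 <= c ->
  (forall y, `|g y| <= c * kernel beta x y) -> Linfty f ->
  mu.-integrable setT (EFin \o (fun y => g y * f y)).
Proof.
move=> dbeta x0 mg c0 gc foo.
have mf := Linfty_measurable foo.
set N := fine (Linfty_norm f).
have N0 : 0 <= N by rewrite fine_ge0// Lnorm_ge0.
apply/integrableP; split; first exact/measurable_EFinP/measurable_funM.
apply: (@le_lt_trans _ _ (\int[mu]_y (N * c * kernel beta x y)%:E)%E); last first.
  under eq_integral do rewrite EFinM.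
  rewrite ge0_integralZl//.
  - by rewrite integral_kernel// -EFinM ltry.
  - by apply/measurable_EFinP; exact: measurable_kernel.
  - by move=> y _; rewrite lee_fin kernel_ge0.
  - by rewrite lee_fin mulr_ge0.
apply: ae_ge0_le_integral => //.
- by apply/measurable_EFinP/measurableT_comp => //; exact: measurable_funM.
- by move=> y _; rewrite lee_fin !mulr_ge0// kernel_ge0.
- by apply/measurable_EFinP/measurable_funM => //; exact: measurable_kernel.
apply: filterS (Linfty_ae_le foo) => y fy _.
rewrite lee_fin normrM mulrC -mulrA ler_pM//.
Qed.

Lemma Linfty_cst1 :
  Linfty (cst 1 : d.-tuple R -> R) /\
  Linfty_norm (cst 1 : d.-tuple R -> R) = 1%E.
Proof.
have N1 : Linfty_norm (cst 1 : d.-tuple R -> R) = 1%E.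
  rewrite /Linfty_norm unlock lebesgue_tuple_setT_gt0.
  apply: ess_sup_ae_cst; first exact: lebesgue_tuple_setT_gt0.
  by apply/nearW => y /=; rewrite normr1.
split=> //; rewrite /Linfty/=; apply/andP; split; rewrite inE/=.
  exact: measurable_cst.
by rewrite /finite_norm -/(Linfty_norm _) N1 ltry.
Qed.

End Linfty_theory.

(** * Differentiation of the potential *)

Lemma derive_along_line (R : realType) (V : normedModType R) (u : V -> R)
    (x v : V) :
  'D_v u x = 'D_1 (fun h : R => u (h *: v + x)) 0.
Proof.
pose U (h : R) := u (h *: v + x).
rewrite -[RHS]/('D_1 U 0) /derive (_ : (fun h : R =>
    h^-1 *: ((U \o shift 0) (h *: 1) - U 0)) =
  (fun h : R => h^-1 *: ((u \o shift x) (h *: v) - u x)))//.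
by apply/funext => h /=; rewrite /U addr0 scaler1 scale0r add0r.
Qed.

Section derivative.
Variables (R : realType) (d : nat) (beta : R).
Hypothesis dbeta : d%:R < beta.
Local Notation mu := (lebesgue_tuple R d).
Implicit Types (f g : d.-tuple R -> R) (x v z : 'rV[R]_d.+1).

Lemma kernel_mass_gt0 : 0 < kernel_mass d beta.
Proof.
rewrite /kernel_mass !mulr_gt0 ?powR_gt0 ?pi_gt0 ?invr_gt0 ?Gamma_gt0//.
  by rewrite divr_gt0// subr_gt0.
by rewrite divr_gt0//; exact: le_lt_trans dbeta.
Qed.

Definition kernel_deriv x v y := beta * kernel beta x y * kernel_slope x v y.

Lemma measurable_kernel_deriv x v : half_space x ->
  measurable_fun [set: d.-tuple R] (kernel_deriv x v).
Proof.
move=> x0; apply: measurable_funM.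
  by apply: measurable_funM => //; exact: measurable_kernel.
apply: measurable_funD => //; apply: measurable_funM.
  exact: measurable_sight_dot.
rewrite (_ : (fun _ => _) =
    fun y => dot (sight x y) (sight x y) `^ (-1)); last first.
  by apply/funext => y; rewrite powR_inv1// ltW// sight_sqr_gt0.
apply: (measurableT_comp (@measurable_powR R _)); exact: measurable_sight_sqr.
Qed.

Let beta0 : 0 < beta. Proof. exact: le_lt_trans dbeta. Qed.

Lemma norm_kernel_deriv_le x v y : half_space x ->
  `|kernel_deriv x v y| <= beta * (2 * norm1 v / x 0 ord_max) * kernel beta x y.
Proof.
move=> x0; rewrite /kernel_deriv 2!normrM (gtr0_norm beta0).
rewrite (ger0_norm (kernel_ge0 _ _ _)) mulrAC ler_wpM2r ?kernel_ge0//.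
by rewrite ler_wpM2l ?(ltW beta0)// norm_kernel_slope_le.
Qed.

Lemma integrable_kernel_deriv x v f : half_space x -> Linfty f ->
  mu.-integrable setT (EFin \o (fun y => kernel_deriv x v y * f y)).
Proof.
move=> x0; apply: (integrable_kernel_mul dbeta x0 (measurable_kernel_deriv v x0)
  _ (fun y => norm_kernel_deriv_le v y x0)).
rewrite mulr_ge0 ?(ltW beta0)// divr_ge0 ?(ltW x0)// mulr_ge0//.
exact: sumr_ge0.
Qed.

Lemma potentialE k f x :
  potential k beta f x = k * \int[mu]_y (kernel beta x y * f y).
Proof. by []. Qed.

(** For small h the derivative of the kernel at x + h v is dominated by a
    multiple of K(x, .), by [kernel_shift_le].  The dominating function keeps
    the factor |f|, because f is bounded almost everywhere only. *)
Lemma cvg_potential k f x v : half_space x -> Linfty f ->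
  h^-1 *: ((potential k beta f \o shift x) (h *: v) - potential k beta f x)
    @[h --> 0^'] -->
  k * \int[mu]_y (kernel_deriv x v y * f y).
Proof.
move=> x0 foo; have x0' : 0 < x 0 ord_max by [].
have V0 : 0 <= norm1 v by exact: sumr_ge0.
(* e * norm1 v <= x_n / 2; the summand 1 keeps the denominator nonzero
   for v = 0. *)
pose e := x 0 ord_max / (2 * (norm1 v + 1)).
have e0 : 0 < e by rewrite divr_gt0// mulr_gt0// ltr_wpDl.
have Iv h : `]- e, e[%classic h -> `|h| * norm1 v <= x 0 ord_max / 2.
  rewrite /= in_itv/= -ltr_norml => he.
  apply: (@le_trans _ _ (e * (norm1 v + 1))).
    by apply: ler_pM => //; [exact: ltW|rewrite lerDl].
  by rewrite /e invfM mulrA divfK// gt_eqF// ltr_wpDl.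
have I0 : `]- e, e[%classic (0 : R) by rewrite /= in_itv/= e0 oppr_lt0 e0.
have hs h : `]- e, e[%classic h -> half_space (h *: v + x).
  move=> /Iv/(half_space_shift x0)/andP[+ _]; apply: lt_le_trans.
  by rewrite divr_gt0.
pose F (h : R) y := kernel beta (h *: v + x) y * f y.
have dF h y : `]- e, e[%classic h ->
    is_derive h 1 (F ^~ y) (kernel_deriv (h *: v + x) v y * f y).
  move=> /hs h0; rewrite mulrC.
  have -> : F ^~ y = f y \*: (fun h => kernel beta (h *: v + x) y).
    by apply/funext => t; rewrite /F mulrC.
  exact: (is_deriveZ (f y) (is_derive_kernel beta y h0)).
(* The bound on the slope at height x_n / 2, times the growth factor of the
   kernel. *)
pose c := beta * (2 * norm1 v / (x 0 ord_max / 2)) * 3 `^ beta.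
have c0 : 0 <= c.
  by rewrite !mulr_ge0 ?powR_ge0 ?(ltW beta0)// invr_ge0 divr_ge0// ltW.
pose G y := `| (c * kernel beta x y) * f y |.
have intF h : `]- e, e[%classic h -> mu.-integrable setT (EFin \o F h).
  move=> /hs h0.
  apply: (integrable_kernel_mul dbeta h0 (measurable_kernel beta h0) ler01
    _ foo).
  by move=> y; rewrite (ger0_norm (kernel_ge0 _ _ _)) -[leLHS]mul1r.
have intG : mu.-integrable setT (EFin \o G).
  apply: (@integrable_abse _ _ _ _ _
    (EFin \o (fun y => (c * kernel beta x y) * f y))).
  apply: (integrable_kernel_mul dbeta x0 _ c0 _ foo).
    by apply: measurable_funM => //; exact: measurable_kernel.
  by move=> y; rewrite ger0_norm// mulr_ge0 ?kernel_ge0.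
have dF1 h y : `]- e, e[%classic h ->
    partial1of2 F h y = kernel_deriv (h *: v + x) v y * f y.
  by move=> /dF - /(_ y)[_]; rewrite partial1of2E.
have G_ub h y : `]- e, e[%classic h -> setT y -> `|partial1of2 F h y| <= G y.
  move=> hI _; rewrite dF1// /G normrM [leRHS]normrM ler_wpM2r//.
  rewrite [leRHS](ger0_norm (mulr_ge0 c0 (kernel_ge0 _ _ _))).
  have /andP[xh _] := half_space_shift x0 (Iv h hI).
  have xn2 : 0 < x 0 ord_max / 2 by rewrite divr_gt0.
  apply: le_trans (norm_kernel_deriv_le v y (hs h hI)) _.
  rewrite /c -[leRHS]mulrA; apply: ler_pM;
    last exact: kernel_shift_le (ltW beta0) (Iv h hI).
  - by apply: mulr_ge0; [exact: ltW|rewrite divr_ge0 ?(ltW (hs h hI))// mulr_ge0].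
  - exact: kernel_ge0.
  - apply: ler_wpM2l; first exact: ltW.
    apply: ler_wpM2l; first exact: mulr_ge0.
    by rewrite lef_pV2 ?posrE//; exact: lt_le_trans xh.
have := @cvg_differentiation_under_integral R _ _ mu F setT measurableT
  0 (- e) e I0 intF (fun h y hI _ => @ex_derive _ _ _ _ _ _ _ (dF h y hI))
  G (fun=> normr_ge0 _) intG G_ub.
rewrite (_ : \int[mu]_y partial1of2 F 0 y =
    \int[mu]_y (kernel_deriv x v y * f y)); last first.
  by apply: eq_Rintegral => y _; rewrite dF1// scale0r add0r.
move=> cvgF; apply: cvg_trans (cvgM (cvg_cst k) cvgF).
apply: near_eq_cvg; near=> h.
rewrite /= !potentialE addr0 /F scale0r add0r -mulrBr.
by rewrite /GRing.scale/= mulrCA.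
Unshelve. all: by end_near. Qed.

Lemma derivable_potential k f x v : half_space x -> Linfty f ->
  derivable (potential k beta f) x v.
Proof.
move=> x0 foo; apply/cvg_ex; eexists; exact: cvg_potential.
Qed.

Lemma derive_potential k f x v : half_space x -> Linfty f ->
  'D_v (potential k beta f) x = k * \int[mu]_y (kernel_deriv x v y * f y).
Proof. by move=> x0 foo; apply/cvg_lim => //; exact: cvg_potential. Qed.

End derivative.

(** * The gradient estimate *)

Section gradient.
Variables (R : realType) (d : nat) (beta : R).
Hypothesis dbeta : d%:R < beta.
Local Notation mu := (lebesgue_tuple R d).
Implicit Types (f : d.-tuple R -> R) (x v z : 'rV[R]_d.+1).

Lemma integrable_kernel x : half_space x ->
  mu.-integrable setT (EFin \o kernel beta x).
Proof.
move=> x0; have [one _] := Linfty_cst1 R d.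
have : mu.-integrable setT
    (EFin \o (fun y => kernel beta x y * (cst 1 : d.-tuple R -> R) y)).
  apply: (integrable_kernel_mul dbeta x0 (measurable_kernel beta x0) ler01
    _ one).
  by move=> y; rewrite mul1r (ger0_norm (kernel_ge0 _ _ _)).
by apply: eq_integrable => // y _ /=; rewrite mulr1.
Qed.

Lemma integrable_kernel_deriv1 x v : half_space x ->
  mu.-integrable setT (EFin \o kernel_deriv beta x v).
Proof.
move=> x0; have [one _] := Linfty_cst1 R d.
apply: (eq_integrable _ (EFin \o (fun y => kernel_deriv beta x v y *
  (cst 1 : d.-tuple R -> R) y))) => //; last exact: integrable_kernel_deriv.
by move=> y _ /=; rewrite mulr1.
Qed.

(** Both sides are the derivative in the direction v of the potential of the
    constant function 1, which is kernel_mass * x_n^d. *)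
Lemma Rintegral_kernel_deriv x v : half_space x ->
  \int[mu]_y kernel_deriv beta x v y =
  kernel_mass d beta * d%:R * x 0 ord_max ^+ d.-1 * v 0 ord_max.
Proof.
move=> x0; have x0' : 0 < x 0 ord_max by [].
have [one _] := Linfty_cst1 R d.
pose u := potential 1 beta (cst 1 : d.-tuple R -> R).
have uE t : half_space t -> u t = kernel_mass d beta * t 0 ord_max ^+ d.
  move=> t0; rewrite /u potentialE mul1r.
  under eq_Rintegral do rewrite mulr1.
  by rewrite /Rintegral integral_kernel.
transitivity ('D_v u x).
  rewrite derive_potential// mul1r.
  by apply: eq_Rintegral => y _; rewrite mulr1.
rewrite derive_along_line.
have dX := is_derive_affine (v 0 ord_max) (x 0 ord_max) (0 : R).
apply: derive_val.
apply: (@near_eq_is_derive _ _ _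
  (kernel_mass d beta \*: (fun h => (h * v 0 ord_max + x 0 ord_max) ^+ d))).
  have cX : {for (0:R), continuous (fun h : R => h * v 0 ord_max + x 0 ord_max)}.
    by apply/differentiable_continuous/derivable1_diffP; case: dX.
  near=> h.
  have Xh : 0 < h * v 0 ord_max + x 0 ord_max.
    by near: h; apply: (cvgr_gt _ cX); rewrite mul0r add0r.
  by rewrite uE /half_space/= !mxE.
have dXd : is_derive (0 : R) 1
    (fun h : R => (h * v 0 ord_max + x 0 ord_max) ^+ d)
    (d%:R * x 0 ord_max ^+ d.-1 * v 0 ord_max).
  rewrite (_ : (fun _ => _) = (fun h : R => h * v 0 ord_max + x 0 ord_max) ^+ d).
    apply: (is_derive_eq (is_deriveX d dX)).
    by rewrite /GRing.scale/= mul0r add0r.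
  by apply/funext => h; rewrite exprfctE.
apply: (is_derive_eq (is_deriveZ _ dXd)).
by rewrite /GRing.scale/= !mulrA.
Unshelve. all: by end_near. Qed.

Lemma partial_last_cst1 k x : half_space x ->
  partial (potential k beta (cst 1 : d.-tuple R -> R)) ord_max x =
  k * (kernel_mass d beta * d%:R * x 0 ord_max ^+ d.-1).
Proof.
move=> x0; have [one _] := Linfty_cst1 R d.
rewrite /partial derive_potential//; congr (_ * _).
transitivity (\int[mu]_y kernel_deriv beta x (delta_mx 0 ord_max) y).
  by apply: eq_Rintegral => y _; rewrite mulr1.
by rewrite Rintegral_kernel_deriv// mxE !eqxx mulr1.
Qed.

Lemma Rintegral_sum n (h : 'I_n -> d.-tuple R -> R) :
  (forall i, mu.-integrable setT (EFin \o h i)) ->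
  \int[mu]_y (\sum_i h i y) = \sum_i \int[mu]_y h i y.
Proof.
move=> ih; apply: EFin_inj; rewrite -sumEFin.
have iE i : (\int[mu]_y h i y)%:E = (\int[mu]_y (h i y)%:E)%E.
  by rewrite /Rintegral fineK//; apply: integrable_fin_num => //; exact: ih.
under [RHS]eq_bigr do rewrite iE.
rewrite -integral_sum// /Rintegral fineK.
  by apply: eq_integral => y _; rewrite sumEFin.
apply: integrable_fin_num => //.
have := @integrable_sum _ _ _ mu setT measurableT _ (index_enum 'I_n) xpredT
  (fun i => EFin \o h i) (fun i _ => ih i).
by apply: eq_integrable => // y _ /=; rewrite sumEFin.
Qed.

Lemma dot_grad_potential k x z f : half_space x -> Linfty f ->
  dot z (grad (potential k beta f) x) =
  k * \int[mu]_y (kernel_deriv beta x z y * f y).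
Proof.
move=> x0 foo.
transitivity (\sum_i k *
    \int[mu]_y (z 0 i * (kernel_deriv beta x (delta_mx 0 i) y * f y))).
  apply: eq_bigr => i _; rewrite mxE /partial derive_potential//.
  rewrite mulrCA RintegralZl//; exact: integrable_kernel_deriv.
rewrite -mulr_sumr -Rintegral_sum; last first.
  move=> i; have := integrable_kernel_deriv dbeta (delta_mx 0 i) x0 foo.
  by move=> /(integrableZl measurableT (z 0 i)); apply: eq_integrable.
congr (_ * _); apply: eq_Rintegral => y _; rewrite /kernel_deriv kernel_slope_sum.
rewrite mulr_sumr mulr_suml; apply: eq_bigr => i _; ring.
Qed.

(** Integrating the Thales bound gives, up to the factor
    kernel_mass * x_n^(d-1), the convex combination
    d z_n^2 + (beta / 2) (1 - z_n^2), whose largest value is d, reached for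
    z = e_n, because beta / 2 <= d. *)
Lemma integral_norm_kernel_deriv_le x z :
  beta <= 2 * d%:R -> half_space x -> dot z z = 1 ->
  \int[mu]_y `|kernel_deriv beta x z y| <=
  kernel_mass d beta * d%:R * x 0 ord_max ^+ d.-1.
Proof.
move=> beta2 x0 z1; have x0' : 0 < x 0 ord_max by [].
have beta0 : 0 < beta by exact: le_lt_trans dbeta.
have d0 : (0 < d)%N.
  rewrite lt0n; apply: contra_ltN dbeta => /eqP d0.
  by move: beta2; rewrite d0 mulr0.
have zn1 : 0 <= 1 - z 0 ord_max ^+ 2.
  rewrite subr_ge0 -z1 /dot (bigD1 ord_max)//= -expr2 lerDl sumr_ge0// => i _.
  by rewrite -expr2 sqr_ge0.
set zn := z 0 ord_max in zn1 *.
pose c := beta * (1 - zn ^+ 2) / (2 * x 0 ord_max).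
have ikd := integrable_kernel_deriv1 z x0.
have iK := integrable_kernel x0.
have izkd : mu.-integrable setT (EFin \o (fun y => zn * kernel_deriv beta x z y)).
  by have := integrableZl measurableT zn ikd; apply: eq_integrable.
have icK : mu.-integrable setT (EFin \o (fun y => c * kernel beta x y)).
  by have := integrableZl measurableT c iK; apply: eq_integrable.
apply: (@le_trans _ _
    (\int[mu]_y (zn * kernel_deriv beta x z y + c * kernel beta x y))).
  apply: le_Rintegral => //.
  - exact: (integrable_norm ikd).
  - by have := integrableD measurableT izkd icK; apply: eq_integrable.
  move=> y _; rewrite /kernel_deriv 2!normrM.
  rewrite (gtr0_norm beta0) (ger0_norm (kernel_ge0 _ _ _)).
  have bK : 0 <= beta * kernel beta x y by rewrite mulr_ge0 ?kernel_ge0// ltW.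
  apply: le_trans (ler_wpM2l bK (norm_kernel_slope_le_unit y x0 z1)) _.
  rewrite -/zn /c le_eqVlt; apply/orP; left; apply/eqP.
  by field; rewrite gt_eqF.
rewrite RintegralD// !RintegralZl// Rintegral_kernel_deriv// -/zn.
rewrite {1}/Rintegral integral_kernel//=.
have M0 := ltW (kernel_mass_gt0 dbeta).
have -> : x 0 ord_max ^+ d = x 0 ord_max * x 0 ord_max ^+ d.-1.
  by rewrite -exprS prednK.
rewrite /c.
set M := kernel_mass d beta in M0 *; set X := x 0 ord_max ^+ d.-1.
have MX : 0 <= M * X by rewrite mulr_ge0// exprn_ge0// ltW.
rewrite [leLHS](_ : _ =
    M * X * (zn ^+ 2 * d%:R + (1 - zn ^+ 2) * (beta / 2))); last first.
  by field; rewrite gt_eqF.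
rewrite [leRHS](_ : _ = M * X * d%:R); last by ring.
rewrite ler_wpM2l//; nra.
Qed.

Lemma norm_Rintegral_kernel_deriv_le x z f : beta <= 2 * d%:R -> half_space x ->
  dot z z = 1 -> Linfty f ->
  `|\int[mu]_y (kernel_deriv beta x z y * f y)| <=
  kernel_mass d beta * d%:R * x 0 ord_max ^+ d.-1 * fine (Linfty_norm f).
Proof.
move=> beta2 x0 z1 foo; set N := fine (Linfty_norm f).
have ikf := integrable_kernel_deriv dbeta z x0 foo.
have ikd := integrable_norm (integrable_kernel_deriv1 z x0).
have N0 : 0 <= N by rewrite fine_ge0// Lnorm_ge0.
have mkd := measurable_kernel_deriv beta z x0.
apply: le_trans (ler_wpM2r N0 (integral_norm_kernel_deriv_le beta2 x0 z1)).
rewrite -RintegralZr// -lee_fin EFin_normr_Rintegral//.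
have mf := Linfty_measurable foo.
apply: le_trans (le_abse_integral _ _ _) _ => //.
  by apply/measurable_EFinP; exact: measurable_funM.
rewrite /Rintegral fineK; last first.
  apply: integrable_fin_num => //.
  by apply: eq_integrable (integrableZr measurableT N ikd).
apply: ae_ge0_le_integral => //.
- apply: measurableT_comp => //.
  by apply/measurable_EFinP; exact: measurable_funM.
- by move=> y _; rewrite lee_fin mulr_ge0.
- by apply/measurable_EFinP; apply: measurable_funM => //; exact: measurableT_comp.
apply: filterS (Linfty_ae_le foo) => y fy _ /=.
by rewrite lee_fin normrM ler_wpM2l.
Qed.

(** The norm of the gradient is the derivative in its own direction. *)
Lemma enorm_grad_potential_le k x f :
  beta <= 2 * d%:R -> half_space x -> Linfty f ->
  enorm (grad (potential k beta f) x) <=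
  `|k| * (kernel_mass d beta * d%:R * x 0 ord_max ^+ d.-1)
    * fine (Linfty_norm f).
Proof.
move=> beta2 x0 foo; set g := grad _ x.
have N0 : 0 <= fine (Linfty_norm f) by rewrite fine_ge0// Lnorm_ge0.
have M0 : 0 <= kernel_mass d beta * d%:R * x 0 ord_max ^+ d.-1.
  apply: mulr_ge0; last by rewrite exprn_ge0// ltW.
  by rewrite mulr_ge0// ltW// kernel_mass_gt0.
have [->|g0] := eqVneq (enorm g) 0; first by rewrite mulr_ge0// mulr_ge0.
pose z := (enorm g)^-1 *: g.
have z1 : dot z z = 1.
  by rewrite /z dotZl [dot g _]dotC dotZl -enorm_sqr expr2 mulKf// mulVf.
have -> : enorm g = dot z g by rewrite /z dotZl -enorm_sqr expr2 mulKf.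
rewrite dot_grad_potential//; apply: le_trans (ler_norm _) _.
rewrite normrM -mulrA ler_wpM2l//.
exact: norm_Rintegral_kernel_deriv_le.
Qed.

End gradient.

(** * Sharpness *)

Section sharpness.
Variables (R : realType) (d : nat).

Lemma sup_max (S : set R) (C : R) : S C -> ubound S C -> sup S = C.
Proof.
move=> SC ubC; apply/eqP; rewrite eq_le; apply/andP; split.
  by apply: ge_sup => //; exists C.
by apply: ub_le_sup => //; exists C.
Qed.

(** The constant 1 has norm 1, hence it is an extremal function for Q, and it
    belongs to the unit ball over which the supremum is taken. *)
Lemma sharp_at_cst1 (Q : (d.-tuple R -> R) -> R) (C : R) : 0 <= C ->
  (forall f, Linfty f -> Q f <= C * fine (Linfty_norm f)) -> Q (cst 1) = C ->
  is_sharp_coefficient Q C /\ sup [set Q f | f in Linfty_ball] = C.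
Proof.
move=> C0 QC Q1; have [one N1] := Linfty_cst1 R d.
split; last first.
  apply: sup_max; first by exists (cst 1) => //; split=> //; rewrite N1.
  move=> _ [f [foo fN] <-]; apply: le_trans (QC f foo) _.
  rewrite ler_piMr// -lee_fin fineK//; exact: Linfty_norm_fin.
split.
  move=> f foo; rewrite -[Linfty_norm f]fineK ?Linfty_norm_fin//.
  by rewrite -EFinM lee_fin QC.
move=> C' /(_ _ one); rewrite N1 mule1 lee_fin Q1.
by [].
Qed.

End sharpness.

Set Strict Implicit.
Unset Implicit Arguments.
Set Printing Implicit Defensive.

Theorem theorem5 (R : realType) (n : nat) (hn : (3 <= n)%N)
    (beta : R) (hbeta : n%:R - 1 < beta <= n%:R) (k : R)
    (x : 'rV[R]_n.-1.+1) (hx : half_space x) :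
  let u (f : n.-1.-tuple R -> R) := potential k beta f in
  let C := `|k| * pi `^ ((n%:R - 1) / 2) * (n%:R - 1)
             * Gamma ((beta - n%:R + 1) / 2) / Gamma (beta / 2)
             * x 0 ord_max ^+ (n - 2) in
  [/\ forall f, Linfty f ->
        forall i, derivable (u f) x (delta_mx 0 i),
      is_sharp_coefficient (fun f => enorm (grad (u f) x)) C,
      is_sharp_coefficient (fun f => `|partial (u f) ord_max x|) C &
      sup [set `|partial (u f) ord_max x| | f in Linfty_ball] =
      sup [set enorm (grad (u f) x) | f in Linfty_ball] ].
Proof.
case: n hn hbeta x hx => // d d2.
rewrite -natr1 addrK => /andP[dbeta betad] x hx u C.
rewrite /= in x hx u C *.
have beta2 : beta <= 2 * d%:R.
  apply: le_trans betad _; rewrite mulr_natl mulr2n lerD2l ler1n.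
  exact: ltnW (d2 : (1 < d)%N).
have CE : C = `|k| * (kernel_mass d beta * d%:R * x 0 ord_max ^+ d.-1).
  rewrite /C /kernel_mass subSS subn1.
  have -> : beta - (d%:R + 1) + 1 = beta - d%:R by ring.
  by ring.
have M0 : 0 <= kernel_mass d beta * d%:R * x 0 ord_max ^+ d.-1.
  apply: mulr_ge0; last by rewrite exprn_ge0// ltW.
  by rewrite mulr_ge0// ltW// kernel_mass_gt0.
have C0 : 0 <= C by rewrite CE mulr_ge0.
have grad_le f : Linfty f -> enorm (grad (u f) x) <= C * fine (Linfty_norm f).
  by move=> foo; rewrite CE; exact: enorm_grad_potential_le.
have partial_le f : `|partial (u f) ord_max x| <= enorm (grad (u f) x).
  by have := norm_le_enorm (grad (u f) x) ord_max; rewrite mxE.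
have partial1 : `|partial (u (cst 1)) ord_max x| = C.
  by rewrite partial_last_cst1// normrM (ger0_norm M0).
have grad1 : enorm (grad (u (cst 1)) x) = C.
  have [one one1] := Linfty_cst1 R d.
  apply/eqP; rewrite eq_le -{2}partial1 partial_le andbT.
  by have := grad_le _ one; rewrite one1 mulr1.
have [gsharp gsup] := sharp_at_cst1 C0 grad_le grad1.
have [psharp psup] := sharp_at_cst1 C0
  (fun f foo => le_trans (partial_le f) (grad_le f foo)) partial1.
split=> //; last by rewrite gsup psup.
by move=> f foo i; exact: derivable_potential.
Qed.
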